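(* Let $T\ge 1$, $L>0$, and let $f_1,\dots,f_T:\mathbb{R}^d\to\mathbb{R}$ be convex and $L$-smooth. Let $f=\frac1T\sum_{t=1}^T f_t$, assume $f$ has a minimizer $x_*\in\arg\min f$, and let $\sigma_*^2:=\frac1T\sum_{t=1}^T\|\nabla f_t(x_* )\|^2<\infty$. Let $\alpha,\beta>0$ satisfy $\frac1\alpha+\frac1\beta\le\frac12$. If the step size of the Incremental Proximal Method is fixed with $0<\eta\le\frac{1}{\sqrt\beta\,TL}$, then its output $x_K$ after $K$ epochs from $x_0$ satisfies $$f(x_K)-f(x_* )\le \mathrm{e}\,\eta^2T^2\sigma_*^2L\,(1+\beta/\alpha)\,K^{\frac{\alpha/\beta}{1+\alpha/\beta}}+\frac{\mathrm{e}\,\|x_0-x_*\|^2}{2T\eta K^{\frac{1}{1+\alpha/\beta}}}.$$ Moreover, with $\alpha=4$, $\beta=4\log K$, for every $\epsilon>0$ there is a constant step size $\eta$ such that $f(x_K)-f(x_* )\le\epsilon$ after $$TK=\widetilde{\mathcal{O}}\Big(\frac{TL\|x_0-x_*\|^2}{\epsilon}+\frac{TL^{1/2}\sigma_*\|x_0-x_*\|^2}{\epsilon^{3/2}}\Big)$$ individual proximal oracle queries.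
   Context: $\|\cdot\|$ is the Euclidean norm on $\mathbb{R}^d$. A differentiable $g$ is $L$-smooth if $\|\nabla g(x)-\nabla g(y)\|\le L\|x-y\|$ for all $x,y$. For convex $g$ and $\eta>0$, $\mathrm{prox}_{\eta g}(x)=\arg\min_{y\in\mathbb{R}^d}\{\frac{1}{2\eta}\|y-x\|^2+g(y)\}$. Incremental Proximal Method (IPM): given $x_0\in\mathbb{R}^d$, number of epochs $K$, and step sizes $\eta_k>0$ (here $\eta_k=\eta$); for $k=1,\dots,K$ set $x_{k-1,1}=x_{k-1}$, then for $t=1,\dots,T$ set $x_{k-1,t+1}=\mathrm{prox}_{\eta_k f_t}(x_{k-1,t})$, and set $x_k=x_{k-1,T+1}$. The output is $x_K$; each epoch uses $T$ individual proximal oracle queries. Convention for the complexity claim: $\widetilde{\mathcal O}(X)$ means at most $C\,X\,(\log(\mathrm{e}+X))^p$ for absolute constants $C,p>0$, and the claim is that there exist an integer $K$ (with $\log K\ge1$) and a step size $\eta$ (allowed to depend on $K$ and the problem parameters) for which $f(x_K)-f(x_* )\le\epsilon$ and $TK=\widetilde{\mathcal O}(X)$; as usual the bound is read in the regime $X\ge T$ (at least one epoch). *)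

(* Defs.v *)
From mathcomp Require Export all_boot all_order all_algebra.
From mathcomp Require Export all_classical all_reals all_analysis.
Export numFieldNormedType.Exports.

Set Implicit Arguments.
Unset Strict Implicit.
Unset Printing Implicit Defensive.

Import Order.TTheory GRing.Theory Num.Theory.

Local Open Scope classical_set_scope.
Local Open Scope ring_scope.

(* The library norm on 'rV[R]_d is the sup norm; it induces the same topology,
   hence the same notion of differentiability, as enorm. *)
Definition enorm (R : realType) (d : nat) (x : 'rV[R]_d) : R :=
  Num.sqrt (\sum_(i < d) x 0 i ^+ 2).

Definition grad (R : realType) (d : nat) (g : 'rV[R]_d -> R) (x : 'rV[R]_d)
    : 'rV[R]_d :=
  \row_(i < d) 'D_(delta_mx 0 i) g x.

Definition smooth (R : realType) (d : nat) (L : R) (g : 'rV[R]_d -> R) : Prop :=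
  (forall x, differentiable g x) /\
  (forall x y, enorm (grad g x - grad g y) <= L * enorm (x - y)).

Definition convex_fun (R : realType) (d : nat) (g : 'rV[R]_d -> R) : Prop :=
  convex_function setT g.

Definition argmin (R : realType) (V : Type) (F : V -> R) : set V :=
  [set y | forall z, F y <= F z].

(* The argmin is a singleton when g is convex and differentiable and 0 < eta;
   xget x picks its element (its default value x is then irrelevant). *)
Definition prox (R : realType) (d : nat) (eta : R) (g : 'rV[R]_d -> R)
    (x : 'rV[R]_d) : 'rV[R]_d :=
  xget x (argmin (fun y => (2 * eta)^-1 * enorm (y - x) ^+ 2 + g y)).

(* enum 'I_T is increasing: the components are processed in the order of
   their indices. *)
Definition ipm_epoch (R : realType) (d T : nat) (eta : R)
    (f : 'I_T -> 'rV[R]_d -> R) (x : 'rV[R]_d) : 'rV[R]_d :=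
  foldl (fun y t => prox eta (f t) y) x (enum 'I_T).

Fixpoint ipm (R : realType) (d T : nat) (eta : nat -> R)
    (f : 'I_T -> 'rV[R]_d -> R) (x0 : 'rV[R]_d) (k : nat) : 'rV[R]_d :=
  if k is k'.+1 then ipm_epoch (eta k) f (ipm eta f x0 k') else x0.

Definition favg (R : realType) (d T : nat) (f : 'I_T -> 'rV[R]_d -> R)
    (x : 'rV[R]_d) : R :=
  T%:R^-1 * \sum_(t < T) f t x.

Definition sigma2 (R : realType) (d T : nat) (f : 'I_T -> 'rV[R]_d -> R)
    (x : 'rV[R]_d) : R :=
  T%:R^-1 * \sum_(t < T) enorm (grad (f t) x) ^+ 2.

Definition query_scale (R : realType) (d T : nat) (L : R)
    (f : 'I_T -> 'rV[R]_d -> R) (x0 xs : 'rV[R]_d) (eps : R) : R :=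
  T%:R * L * enorm (x0 - xs) ^+ 2 / eps
  + T%:R * Num.sqrt L * Num.sqrt (sigma2 f xs) * enorm (x0 - xs) ^+ 2
    / eps `^ (3 / 2).

(* Main.v *)
(* Write [F := favg f - favg f xs]. A proximal step is an implicit gradient
   step, so smoothness at the end point [x'] of an epoch from [x], combined with
   the co-coercive lower bound on each [f t] at an arbitrary point [z], gives
     F x' <= (1 + alpha/beta) F z + (|x - z|^2 - |x' - z|^2) / (2 eta T) + E,
   with [E = eta^2 T^2 L sigma^2]. For the last iterate one lets [z] move: when
   [m] epochs remain after [x'], the point [z] is replaced by the convex
   combination [l z + (1 - l) x'] with [l = w (m+1) / w m]. With the weights
   [w m = m^-s], [s = 1 / (1 + alpha/beta)], Bernoulli's inequality makes all
   intermediate values of [F] cancel. *)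
From mathcomp Require Import ring lra.
Require Import Defs.

Set Implicit Arguments.
Unset Strict Implicit.
Unset Printing Implicit Defensive.

Import Order.TTheory GRing.Theory Num.Theory.
Local Open Scope classical_set_scope.
Local Open Scope ring_scope.

(** * Euclidean inner product and Young inequalities *)

Section Dot.
Context {R : realType} {d : nat}.
Implicit Types (u v w : 'rV[R]_d) (a : R).

Definition dot u v : R := \sum_(i < d) u 0 i * v 0 i.

Lemma dotC u v : dot u v = dot v u.
Proof. by apply: eq_bigr => i _; rewrite mulrC. Qed.

Lemma dotDl u v w : dot (u + v) w = dot u w + dot v w.
Proof. by rewrite -big_split; apply: eq_bigr => i _; rewrite mxE mulrDl. Qed.

Lemma dotZl a u v : dot (a *: u) v = a * dot u v.
Proof. by rewrite mulr_sumr; apply: eq_bigr => i _; rewrite mxE mulrA. Qed.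

Lemma dotNl u v : dot (- u) v = - dot u v.
Proof. by rewrite -scaleN1r dotZl mulN1r. Qed.

Lemma dot0l v : dot 0 v = 0.
Proof. by rewrite -(scale0r v) dotZl mul0r. Qed.

Lemma dotDr u v w : dot w (u + v) = dot w u + dot w v.
Proof. by rewrite dotC dotDl !(dotC w). Qed.

Lemma dotZr a u v : dot v (a *: u) = a * dot v u.
Proof. by rewrite dotC dotZl (dotC v). Qed.

Lemma dotNr u v : dot v (- u) = - dot v u.
Proof. by rewrite dotC dotNl (dotC v). Qed.

Lemma dot_suml (I : finType) (P : pred I) (F : I -> 'rV[R]_d) v :
  dot (\sum_(i | P i) F i) v = \sum_(i | P i) dot (F i) v.
Proof.
apply: (big_morph (fun u => dot u v) (fun x y => dotDl x y v)).
exact: dot0l.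
Qed.

Definition dotE := (dotDl, dotDr, dotNl, dotNr, dotZl, dotZr).

Lemma dot_ge0 u : 0 <= dot u u.
Proof. by apply: sumr_ge0 => i _; rewrite -expr2 sqr_ge0. Qed.

Lemma dot_eq0 u : dot u u = 0 -> u = 0.
Proof.
move=> u0; apply/rowP => i; rewrite mxE; apply/eqP; rewrite -sqrf_eq0 expr2.
by apply/eqP; apply: (psumr_eq0P _ u0) => // j _; rewrite -expr2 sqr_ge0.
Qed.

Lemma enorm_sqr u : enorm u ^+ 2 = dot u u.
Proof.
rewrite sqr_sqrtr; last by apply: sumr_ge0 => i _; rewrite sqr_ge0.
by apply: eq_bigr => i _; rewrite expr2.
Qed.

Lemma enormN u : enorm (- u) = enorm u.
Proof. by congr Num.sqrt; apply: eq_bigr => i _; rewrite mxE sqrrN. Qed.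

Lemma dot_young a u v : 0 < a -> dot u v <= dot u u / (2 * a) + a / 2 * dot v v.
Proof.
move=> a0; have := dot_ge0 (u - a *: v); rewrite !dotE (dotC v u) => H.
have -> : dot u u / (2 * a) + a / 2 * dot v v =
    dot u v + (dot u u - a * dot u v - (a * dot u v - a * (a * dot v v))) / (2 * a).
  by field; rewrite gt_eqF.
by rewrite lerDl; apply: divr_ge0; [nra | lra].
Qed.

Lemma sqr_coord_le_dot u i : u 0 i ^+ 2 <= dot u u.
Proof.
rewrite /dot (bigD1 i) //= -expr2 lerDl.
by apply: sumr_ge0 => j _; rewrite -expr2 sqr_ge0.
Qed.

Lemma dot_sum_le (I : finType) (P : pred I) (F : I -> 'rV[R]_d) :
  dot (\sum_(i | P i) F i) (\sum_(i | P i) F i)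
    <= #|I|%:R * \sum_i dot (F i) (F i).
Proof.
set S := \sum_(i | P i) F i; set n : R := #|I|%:R.
have [I0|I0] := posnP #|I|.
  have -> : S = 0 by apply: big1 => i; have := fintype0 i; rewrite I0.
  by rewrite dot0l mulr_ge0 ?sumr_ge0 // => *; exact: dot_ge0.
have n0 : 0 < n by rewrite ltr0n.
(* Young's inequality with weight [1/n]: the [n] copies of [|S|^2 / (2n)] add up to [|S|^2 / 2],
   which the left side absorbs. Indices outside [P] only enlarge the right side. *)
have young i : dot (F i) S <= n / 2 * dot (F i) (F i) + dot S S / (2 * n).
  have := @dot_young n^-1 (F i) S; rewrite invr_gt0 => /(_ n0).
  suff -> : dot (F i) (F i) / (2 / n) + n^-1 / 2 * dot S S =
    n / 2 * dot (F i) (F i) + dot S S / (2 * n) by [].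
  by field; rewrite gt_eqF.
have : dot S S <= \sum_i (n / 2 * dot (F i) (F i) + dot S S / (2 * n)).
  apply: (@le_trans _ _ (\sum_(i | P i) dot (F i) S)); first by rewrite -dot_suml.
  rewrite [leLHS]big_mkcond; apply: ler_sum => i _; case: ifP => _; first exact: young.
  by rewrite addr_ge0 ?mulr_ge0 ?dot_ge0 ?invr_ge0 // ?mulr_ge0 // ltW.
rewrite big_split /= sumr_const -mulr_sumr -[_ *+ #|_|]mulr_natr -/n.
have -> : dot S S / (2 * n) * n = dot S S / 2 by field; rewrite gt_eqF.
lra.
Qed.

End Dot.

(** * Smooth convex functions and the proximal step *)

Section Smooth.
Context {R : realType} {d : nat}.
Implicit Types (g : 'rV[R]_d -> R) (x y z u v : 'rV[R]_d) (L : R).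

Lemma derive_grad g x v : differentiable g x -> 'D_v g x = dot (grad g x) v.
Proof.
move=> dg; rewrite deriveE // {1}(row_sum_delta v) linear_sum.
by apply: eq_bigr => i _; rewrite linearZ /= mxE deriveE // mulrC.
Qed.

Lemma is_derive_line g x v (t : R) : differentiable g (x + t *: v) ->
  is_derive t 1 (fun s : R => g (x + s *: v)) (dot (grad g (x + t *: v)) v).
Proof.
move=> dg; rewrite -derive_grad //.
have E : (fun h : R => h^-1 *: (((fun s : R => g (x + s *: v)) \o shift t)
      (h *: (1 : R)) - g (x + t *: v)))
    = (fun h : R => h^-1 *: ((g \o shift (x + t *: v)) (h *: v) - g (x + t *: v))).
  apply/funext => h /=; congr (_ *: (g _ - _)).
  by rewrite [h *: _]mulr1 scalerDl addrA [in RHS]addrC addrAC.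
apply: DeriveDef; first by rewrite /derivable E; exact: diff_derivable.
by rewrite /derive E.
Qed.

Lemma gradN g x : differentiable g x -> grad (fun x => - g x) x = - grad g x.
Proof.
by move=> dg; apply/rowP => i; rewrite !mxE deriveN //; exact: diff_derivable.
Qed.

Lemma smoothN L g : smooth L g -> smooth L (fun x => - g x).
Proof.
move=> [dg Lg]; split=> [x|x y]; first exact: differentiableN.
by rewrite !gradN // -opprD enormN.
Qed.

Lemma smooth_sqr L g x y : 0 < L -> smooth L g ->
  dot (grad g x - grad g y) (grad g x - grad g y) <= L ^+ 2 * dot (x - y) (x - y).
Proof.
move=> L0 [_ Lg]; rewrite -!enorm_sqr -exprMn.
by rewrite lerXn2r ?nnegrE ?mulr_ge0 ?sqrtr_ge0 // ltW.
Qed.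

Lemma descent L g x y : 0 < L -> smooth L g ->
  g y <= g x + dot (grad g x) (y - x) + L / 2 * dot (y - x) (y - x).
Proof.
move=> L0 Sg; have dg := Sg.1; set v := y - x.
pose c := dot (grad g x) v; pose q := L / 2 * dot v v.
(* The mean value theorem replaces the usual integral along the segment: [p 0] is [g x], [p 1] is
   [g y - c - q], and [p] has nonpositive derivative on the open interval. *)
pose p (t : R) := g (x + t *: v) - t * c - t ^+ 2 * q.
pose dp (t : R) := dot (grad g (x + t *: v)) v - c - 2 * t * q.
have Dp (t : R) : is_derive t (1 : R) p (dp t).
  have D1 := is_derive_line (dg (x + t *: v)).
  have -> : p = (fun s : R => g (x + s *: v)) - c \*: id - q \*: (id ^+ 2).
    by apply/funext => s; rewrite /p !fctE /= /GRing.scale /=; ring.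
  by apply: is_derive_eq; rewrite /dp /GRing.scale /=; ring.
have pc : {within `[0, 1], continuous p}.
  by apply: derivable_within_continuous => t _; have := Dp t; case.
have [t /[!in_itv]/= /andP[t0 t1]] := MVT ltr01 (fun t _ => Dp t) pc.
have : dp t <= 0.
  rewrite /dp /c -dotNl -dotDl /q.
  (* Young's inequality with weight [L t] balances the two terms: each is at most [L t |v|^2 / 2],
     so together they match the derivative [2 t q]. *)
  have Lt0 : 0 < L * t by rewrite mulr_gt0.
  have := dot_young (grad g (x + t *: v) - grad g x) v Lt0.
  have := smooth_sqr (x + t *: v) x L0 Sg.
  rewrite addrAC subrr add0r dotZl dotZr => H1 H2.
  rewrite subr_le0 (le_trans H2) //.
  have : dot (grad g (x + t *: v) - grad g x) (grad g (x + t *: v) - grad g x)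
      / (2 * (L * t)) <= L ^+ 2 * (t * (t * dot v v)) / (2 * (L * t)).
    by rewrite ler_wpM2r // invr_ge0 mulr_ge0 ?ltW.
  have -> : L ^+ 2 * (t * (t * dot v v)) / (2 * (L * t)) = L * t / 2 * dot v v.
    by field; rewrite !gt_eqF.
  lra.
have xv : x + v = y by rewrite addrC subrK.
by rewrite /p scale1r scale0r addr0 xv -/c -/q => dp0 E; lra.
Qed.

Lemma ascent L g x y : 0 < L -> smooth L g ->
  g x + dot (grad g x) (y - x) - L / 2 * dot (y - x) (y - x) <= g y.
Proof.
move=> L0 Sg; have := descent x y L0 (smoothN Sg).
by rewrite (gradN (Sg.1 x)) dotNl; lra.
Qed.

Lemma convex_funP g x y (t : R) : convex_fun g -> 0 <= t <= 1 ->
  g (t *: x + (1 - t) *: y) <= t * g x + (1 - t) * g y.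
Proof.
move=> cg /andP[t0 t1].
by have := cg (Itv01 t0 t1) x y; rewrite !inE => /(_ Logic.I Logic.I).
Qed.

(** Divide by [t] and let [t] tend to 0. Concretely, if [a > 0], the witness [t = a / (2 (a + |b|))]
    gives [t b <= a / 2 < a]. *)
Lemma le0_small_slope (a b : R) :
  (forall t : R, 0 < t <= 1 -> t * a <= t ^+ 2 * b) -> a <= 0.
Proof.
move=> H; rewrite leNgt; apply/negP => a0.
pose M := a + `|b|; have M0 : 0 < M by rewrite ltr_pwDl.
pose t := a / (2 * M).
have t0 : 0 < t by rewrite divr_gt0 // mulr_gt0.
have tM : t * M = a / 2 by rewrite /t; field; rewrite gt_eqF.
have b1 : b <= `|b| := ler_norm b.
have : 0 < t <= 1.
  rewrite t0 /= ler_pdivrMr ?mulr_gt0 // mul1r /M.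
  by have := normr_ge0 b; lra.
move=> /H; rewrite expr2 -mulrA ler_pM2l // => H1.
have : t * b <= t * M by rewrite ler_pM2l // /M; lra.
by rewrite tM; lra.
Qed.

(** First-order optimality without differentiating [h]: at [u = y - t p] the quadratic majorant and
    minimality give [t |p|^2 <= t^2 M |p|^2] for small [t]. It serves both the proximal objective
    and the sum of the [f t]. *)
Lemma argmin_slope0 (h : 'rV[R]_d -> R) y p (M : R) :
  argmin h y ->
  (forall u, h u <= h y + dot p (u - y) + M * dot (u - y) (u - y)) -> p = 0.
Proof.
move=> hy H; apply: dot_eq0; apply/eqP; rewrite eq_le dot_ge0 andbT.
apply: (@le0_small_slope _ (M * dot p p)) => t _.
have := H (y - t *: p); rewrite [y - _ - y]addrAC subrr add0r !dotE => H1.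
by have := hy (y - t *: p); nra.
Qed.

(** On the segment from [x] to [y], convexity bounds [g] above and [ascent] bounds it below; the
    curvature error is of order [t^2], so the slopes compare. *)
Lemma convex_grad_le L g x y : 0 < L -> smooth L g -> convex_fun g ->
  g x + dot (grad g x) (y - x) <= g y.
Proof.
move=> L0 Sg cg; rewrite -subr_le0.
apply: (@le0_small_slope _ (L / 2 * dot (y - x) (y - x))) => t /andP[t0 t1].
have t01 : 0 <= t <= 1 by rewrite ltW.
have := convex_funP y x cg t01.
have -> : t *: y + (1 - t) *: x = x + t *: (y - x).
  by rewrite scalerBl scalerBr scale1r addrCA addrA.
have := ascent x (x + t *: (y - x)) L0 Sg.
rewrite [x + _ - x]addrAC subrr add0r !dotZr !dotZl; nra.
Qed.

(* A gradient step of length [1/L] from [z] on [g - <grad g y, ->], which is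
   minimal at [y], decreases it by [|grad g z - grad g y|^2 / (2L)]. *)
Lemma bregman_ge L g y z : 0 < L -> smooth L g -> convex_fun g ->
  g y + dot (grad g y) (z - y)
    + (2 * L)^-1 * dot (grad g y - grad g z) (grad g y - grad g z) <= g z.
Proof.
move=> L0 Sg cg; have [D eD] : exists D, grad g z = grad g y - D.
  by exists (grad g y - grad g z); rewrite opprB addrCA subrr addr0.
have := convex_grad_le y (z + L^-1 *: D) L0 Sg cg.
have := descent z (z + L^-1 *: D) L0 Sg.
rewrite eD opprB addrCA subrr addr0 [z + _ - z]addrAC subrr add0r.
rewrite [z + _ - y]addrAC (dotDr (z - y)) !dotZr !dotZl dotDl dotNl.
have -> : L / 2 * (L^-1 * (L^-1 * dot D D)) = (2 * L)^-1 * dot D D.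
  by field; rewrite gt_eqF.
have : L^-1 * dot D D = 2 * ((2 * L)^-1 * dot D D).
  by field; rewrite gt_eqF.
rewrite mulrBr; lra.
Qed.

Lemma prox_step L g (eta : R) x : 0 < L -> 0 < eta -> smooth L g ->
  convex_fun g -> prox eta g x = x - eta *: grad g (prox eta g x).
Proof.
move=> L0 e0 Sg cg; set F := fun y => (2 * eta)^-1 * enorm (y - x) ^+ 2 + g y.
have FE : F = fun y => (2 * eta)^-1 * dot (y - x) (y - x) + g y.
  by apply/funext => y; rewrite /F enorm_sqr.
have e20 : 0 < (2 * eta)^-1 by rewrite invr_gt0 mulr_gt0.
(* [prox] is an [xget], which would return its default [x] on an empty argmin, so a minimizer has to
   be exhibited first. *)
have Fmin : argmin F !=set0.
  (* Outside the ball of radius [B] around [x], the quadratic term outweighs the largest possible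
     linear decrease of [g], so [F z >= F x]. A minimizer over the compact box [A], which contains
     this ball, is therefore global. *)
  pose B := 2 * eta * enorm (grad g x).
  have B0 : 0 <= B by rewrite !mulr_ge0 ?sqrtr_ge0 // ltW.
  pose A : set 'rV[R]_d := 
    [set v | forall i, `[x 0 i - B, x 0 i + B]%classic (v 0 i)].
  have Ac : compact A.
    apply: (rV_compact (A := fun i => `[x 0 i - B, x 0 i + B]%classic)) => i.
    exact: segment_compact.
  have Ax : A x by move=> i; rewrite /= in_itv /=; lra.
  have Fc : continuous F.
    move=> y; apply: differentiable_continuous; rewrite FE.
    apply: differentiableD; last exact: Sg.1.
    apply: differentiableZ.
    rewrite (_ : (fun y => dot (y - x) (y - x)) =
      \sum_(i < d) ((fun y : 'rV[R]_d => y 0 i) - cst (x 0 i)) ^+ 2); last first.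
      apply/funext => u; rewrite fct_sumE; apply: eq_bigr => i _.
      by rewrite !mxE -expr2.
    apply: differentiable_sum => i; apply: differentiableX.
    by apply: differentiableB => //; exact: differentiable_coord.
  have [c cA cmin] := EVT_min_rV (ex_intro _ x Ax) Ac (continuous_subspaceT Fc).
  exists c => z; have [zB|zB] := leP (dot (z - x) (z - x)) (B ^+ 2).
    apply: cmin; rewrite inE => i /=; rewrite in_itv /=.
    have := le_trans (sqr_coord_le_dot (z - x) i) zB.
    rewrite -ler_sqrt ?sqr_ge0 // !sqrtr_sqr (ger0_norm B0) !mxE ler_norml.
    by move=> /andP[]; lra.
  apply: (@le_trans _ _ (F x)); first by apply: cmin; rewrite inE.
  rewrite FE subrr dot0l mulr0 add0r.
  have H1 := convex_grad_le x z L0 Sg cg.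
  have H2 := dot_young (- grad g x) (z - x) e20.
  move: zB H2; rewrite /B exprMn enorm_sqr dotNl dotNl dotNr opprK => zB H2.
  have : dot (grad g x) (grad g x) / (2 * (2 * eta)^-1)
      <= (2 * eta)^-1 / 2 * dot (z - x) (z - x).
    have -> : dot (grad g x) (grad g x) / (2 * (2 * eta)^-1) =
      (2 * eta)^-1 / 2 * ((2 * eta) ^+ 2 * dot (grad g x) (grad g x)).
      by field; rewrite gt_eqF.
    by rewrite ler_pM2l ?ltW // divr_gt0.
  lra.
have py : argmin F (prox eta g x) by apply: xgetPex; exact: Fmin.
set y := prox eta g x in py *.
suff : eta^-1 *: (y - x) + grad g y = 0.
  move=> /(congr1 (fun u => eta *: u)); rewrite scaler0 scalerDr scalerA.
  rewrite divff ?gt_eqF // scale1r => /eqP; rewrite addrAC subr_eq0 => /eqP <-.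
  by rewrite addrK.
(* The quadratic part of [F] contributes curvature [(2 eta)^-1] exactly, and [descent] for [g]
   contributes [L / 2]. *)
apply: (argmin_slope0 (M := (2 * eta)^-1 + L / 2) py) => u.
have := descent y u L0 Sg; rewrite FE.
have -> : u - x = (u - y) + (y - x) by rewrite addrA subrK.
move: (u - y) (y - x) => v w; rewrite !dotE (dotC w v).
have -> : eta^-1 * dot v w = 2 * ((2 * eta)^-1 * dot v w).
  by field; rewrite gt_eqF.
lra.
Qed.

End Smooth.

(** * Bernoulli's inequality for real powers and the weights [n^-s] *)

Section PowR.
Context {R : realType}.
Implicit Types (s y : R) (n : nat).

(** Concavity of [ln] between [y] and 1 gives [s ln y <= ln (s y + 1 - s)]; the case [y = 0] is
    separate. *)
Lemma powR_bernoulli s y : 0 < s <= 1 -> 0 <= y -> y `^ s <= 1 + s * (y - 1).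
Proof.
move=> /andP[s0 s1]; rewrite le_eqVlt => /predU1P[<-|y0].
  by rewrite powR0 ?gt_eqF //; lra.
have sy : 0 < s * y by rewrite mulr_gt0.
have z0 : 0 < 1 + s * (y - 1) by lra.
have := @concave_ln R (Itv01 (ltW s0) s1) y 1 y0 ltr01.
rewrite !convRE /= ln1 mulr0 addr0 mulr1 => H.
rewrite /powR gt_eqF // -(@lnK R (1 + s * (y - 1))) // ler_expR.
by apply: (le_trans H); rewrite (_ : 1 + _ = s * y + (1 - s)) //; ring.
Qed.

(** Bernoulli at [(n+2)/(n+1)]. Divided by the two powers, it bounds the decrease of the weights
    [w n = n^-s]: [(n+1) (w (n+1) - w (n+2)) <= s w (n+2)]. *)
Lemma powR_succ_le s n : 0 < s <= 1 ->
  n.+1%:R * n.+2%:R `^ s <= (n.+1%:R + s) * n.+1%:R `^ s.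
Proof.
move=> s01; have n0 : 0 < n.+1%:R :> R by rewrite ltr0n.
have nE : n.+2%:R = (n.+2%:R / n.+1%:R) * n.+1%:R :> R by rewrite divfK // gt_eqF.
have q0 : 0 <= n.+2%:R / n.+1%:R :> R by rewrite divr_ge0.
rewrite [in leLHS]nE powRM // mulrA ler_wpM2r ?powR_ge0 //.
have := ler_wpM2l (ltW n0) (powR_bernoulli s01 q0).
suff -> : n.+1%:R * (1 + s * (n.+2%:R / n.+1%:R - 1)) = n.+1%:R + s by [].
by rewrite -(natr1 n.+1); field; rewrite gt_eqF.
Qed.

(** Instead of an integral comparison, induction: Bernoulli with exponent [1 - s] at [n/(n+1)] shows
    that the right side grows by at least [(n+1)^-s]. *)
Lemma sum_powR_le s n : 0 < s < 1 ->
  \sum_(1 <= j < n.+1) (j%:R `^ s)^-1 <= n%:R `^ (1 - s) / (1 - s).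
Proof.
move=> /andP[s0 s1]; have a0 : 0 < 1 - s by lra.
have a01 : 0 < 1 - s <= 1 by lra.
elim: n => [|n IH]; first by rewrite big_geq // powR0 ?gt_eqF // mul0r.
rewrite big_nat_recr //=; apply: le_trans (lerD IH (lexx _)) _.
have n0 : 0 < n.+1%:R :> R by rewrite ltr0n.
have P0 : 0 < n.+1%:R `^ (1 - s) :> R by rewrite powR_gt0.
have -> : (n.+1%:R `^ s)^-1 = n.+1%:R `^ (1 - s) / n.+1%:R :> R.
  rewrite powRD ?powRr1 ?powRN 1?ltW //; last by rewrite gt_eqF // implybT.
  by field; rewrite !gt_eqF ?powR_gt0.
have /(_ (n%:R / n.+1%:R)) := powR_bernoulli a01.
rewrite divr_ge0 // => /(_ isT).
have nE : n%:R = (n%:R / n.+1%:R) * n.+1%:R :> R by rewrite divfK // gt_eqF.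
have -> : n%:R `^ (1 - s) = (n%:R / n.+1%:R) `^ (1 - s) * n.+1%:R `^ (1 - s) :> R.
  by rewrite -powRM ?divr_ge0 // -nE.
move=> H; have := ler_wpM2r (ltW P0) H.
have -> : n%:R / n.+1%:R - 1 = - n.+1%:R^-1 :> R.
  by rewrite -natr1; field; rewrite natr1 gt_eqF.
set P := n.+1%:R `^ (1 - s) => H1.
have -> : P / (1 - s) = (1 + (1 - s) * - n.+1%:R^-1) * P / (1 - s) + P / n.+1%:R.
  by field; rewrite !gt_eqF.
by rewrite lerD2r ler_pM2r ?invr_gt0.
Qed.

End PowR.

(** Cauchy-Schwarz with weights [1/beta], [1/alpha], [1/2], whose sum is at most 1. The proof first
    splits off [c], then completes the square in the remaining form in [a] and [b], multiplied by
    [beta - 2 > 0]. *)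
Lemma sqr_young3 {R : realType} (alpha beta a b c : R) :
  0 < alpha -> 0 < beta -> alpha^-1 + beta^-1 <= 1 / 2 ->
  (a + b + c) ^+ 2 <= beta * a ^+ 2 + alpha * b ^+ 2 + 2 * c ^+ 2.
Proof.
move=> a0 b0 H.
have H1 : 2 * (alpha + beta) <= alpha * beta.
  have := ler_wpM2l (ltW (mulr_gt0 a0 b0)) H.
  have -> : alpha * beta * (alpha^-1 + beta^-1) = alpha + beta.
    by field; rewrite !gt_eqF.
  lra.
have b2 : 0 < beta - 2 by nra.
have Q : 0 <= (beta - 2) * ((beta - 2) * a ^+ 2 - 4 * (a * b) + (alpha - 2) * b ^+ 2).
  have -> : (beta - 2) * ((beta - 2) * a ^+ 2 - 4 * (a * b) + (alpha - 2) * b ^+ 2) =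
     ((beta - 2) * a - 2 * b) ^+ 2 + (alpha * beta - 2 * (alpha + beta)) * b ^+ 2.
    by ring.
  by apply: addr_ge0; rewrite ?sqr_ge0 //; apply: mulr_ge0; rewrite ?sqr_ge0 ?subr_ge0.
rewrite pmulr_rge0 // in Q.
have := sqr_ge0 (c - (a + b)).
have -> : (c - (a + b)) ^+ 2 = 2 * c ^+ 2 + 2 * (a + b) ^+ 2 - (a + b + c) ^+ 2.
  by ring.
have -> : (a + b) ^+ 2 = a ^+ 2 + 2 * (a * b) + b ^+ 2 by ring.
lra.
Qed.

(** * One-epoch inequality and last-iterate bound *)

Section Epoch.
Context {R : realType} {d T : nat}.
Variables (L : R) (f : 'I_T -> 'rV[R]_d -> R) (xs : 'rV[R]_d) (alpha beta eta : R).
Hypotheses (T1 : (1 <= T)%N) (L0 : 0 < L).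
Hypotheses (cf : forall t, convex_fun (f t)) (Sf : forall t, smooth L (f t)).
Hypothesis (xsP : argmin (favg f) xs).
Hypotheses (alpha0 : 0 < alpha) (beta0 : 0 < beta).
Hypothesis (ab : alpha^-1 + beta^-1 <= 1 / 2).
Hypotheses (eta0 : 0 < eta) (etaP : eta <= 1 / (Num.sqrt beta * T%:R * L)).
Implicit Types x y z u v w : 'rV[R]_d.

Let T0 : 0 < T%:R :> R. Proof. by rewrite ltr0n. Qed.

Lemma dot_young3 u v w : dot (u + v + w) (u + v + w) <=
  beta * dot u u + alpha * dot v v + 2 * dot w w.
Proof.
rewrite /dot !mulr_sumr -!big_split /=; apply: ler_sum => i _.
by rewrite !mxE -!expr2 sqr_young3.
Qed.

Lemma favg_sum x : \sum_t f t x = T%:R * favg f x.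
Proof. by rewrite /favg mulrA divff ?mul1r // gt_eqF. Qed.

Lemma sigma2_sum x : \sum_t dot (grad (f t) x) (grad (f t) x) = T%:R * sigma2 f x.
Proof.
rewrite /sigma2 mulrA divff ?mul1r ?gt_eqF //.
by apply: eq_bigr => t _; rewrite enorm_sqr.
Qed.

Lemma sigma2_ge0 x : 0 <= sigma2 f x.
Proof. by rewrite mulr_ge0 ?invr_ge0 // sumr_ge0 // => t _; exact: sqr_ge0. Qed.

Lemma favg_convex x y (l : R) : 0 <= l <= 1 ->
  favg f (l *: x + (1 - l) *: y) <= l * favg f x + (1 - l) * favg f y.
Proof.
move=> l01; rewrite -(ler_pM2l T0) -favg_sum mulrDr (mulrCA _ l) (mulrCA _ (1 - l)).
rewrite -!favg_sum.
by rewrite !mulr_sumr -big_split; apply: ler_sum => t _; exact: convex_funP.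
Qed.

Lemma sum_grad_argmin : \sum_t grad (f t) xs = 0.
Proof.
(* Summing the [T] descent inequalities at [xs] gives a quadratic majorant of the sum whose slope is
   the sum of the gradients. *)
apply: (@argmin_slope0 _ _ (fun x => \sum_t f t x) xs _ (T%:R * (L / 2))).
  by move=> z; rewrite !favg_sum ler_pM2l.
move=> u; rewrite dot_suml -mulrA mulr_natl.
rewrite (_ : _ *+ T = \sum_(t < T) L / 2 * dot (u - xs) (u - xs)); last first.
  by rewrite sumr_const card_ord.
by rewrite -!big_split /=; apply: ler_sum => t _; exact: descent.
Qed.

Lemma epoch_path x : exists y : nat -> 'rV[R]_d,
  [/\ y 0%N = x, y T = ipm_epoch eta f x &
      forall t : 'I_T, y t.+1 = y t - eta *: grad (f t) (y t.+1)].
Proof.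
exists (fun i => foldl (fun y t => prox eta (f t) y) x (take i (enum 'I_T))).
split=> [||t].
- by rewrite take0.
- by rewrite take_oversize // size_enum_ord.
- have tT : (t < size (enum 'I_T))%N by rewrite size_enum_ord.
  rewrite (take_nth t tT) foldl_rcons nth_ord_enum.
  exact: (prox_step _ L0).
Qed.

Lemma path_suffix (y : nat -> 'rV[R]_d) (g : 'I_T -> 'rV[R]_d) (j : nat) :
  (forall t : 'I_T, y t.+1 = y t - eta *: g t) -> (j <= T)%N ->
  y T - y j = - (eta *: \sum_(t < T | (j <= t)%N) g t).
Proof.
move=> yS jT; rewrite -(telescope_sumr _ jT) (big_geq_mkord _ _ predT) /=.
rewrite scaler_sumr -sumrN; apply: eq_bigr => t _.
by rewrite yS addrAC subrr add0r.
Qed.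

Lemma eta_sqr_bound : eta ^+ 2 * T%:R ^+ 2 * L ^+ 2 * beta <= 1.
Proof.
have sb : 0 < Num.sqrt beta by rewrite sqrtr_gt0.
have p0 : 0 < Num.sqrt beta * T%:R * L by rewrite !mulr_gt0.
have := etaP; rewrite ler_pdivlMr // => H.
rewrite -{1}(sqr_sqrtr (ltW beta0)) -!exprMn.
rewrite (_ : eta * T%:R * L * Num.sqrt beta = eta * (Num.sqrt beta * T%:R * L)).
  by rewrite expr_le1 //; apply: mulr_ge0; apply: ltW.
ring.
Qed.

Lemma epoch_sum_bound x z (x' := ipm_epoch eta f x) :
  \sum_t f t x' - \sum_t f t z <= eta^-1 * dot (x - x') (x' - z)
    + alpha / beta * (\sum_t f t z - \sum_t f t xs)
    + T%:R * (eta ^+ 2 * T%:R ^+ 2 * L * sigma2 f xs).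
Proof.
have [y [y0 yT yS]] := epoch_path x; rewrite -/x' in yT.
pose g t := grad (f t) (y t.+1).
pose a t := dot (g t - grad (f t) z) (g t - grad (f t) z).
pose b t := dot (grad (f t) xs - grad (f t) z) (grad (f t) xs - grad (f t) z).
have gE : x - x' = eta *: \sum_t g t.
  have := path_suffix (g := g) yS (leq0n T).
  by rewrite yT y0 -opprB => /oppr_inj.
(* [descent] goes from [y t.+1] to [x'], [bregman_ge] from [y t.+1] to [z]; subtracting cancels
   [f t (y t.+1)]. The cost is the squared drift to the end of the epoch, a sum of later steps; the
   gain is [a t / (2L)]. *)
have per_t t : f t x' - f t z <= dot (g t) (x' - z)
    + L / 2 * (eta ^+ 2 * T%:R * \sum_s dot (g s) (g s)) - (2 * L)^-1 * a t.
  have D := descent (y t.+1) x' L0 (Sf t).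
  have B := bregman_ge (y t.+1) z L0 (Sf t) (cf t).
  have q : dot (x' - y t.+1) (x' - y t.+1) <=
      eta ^+ 2 * T%:R * \sum_s dot (g s) (g s).
    have := path_suffix (g := g) yS (ltn_ord t).
    rewrite yT => ->; rewrite dotNl dotNr opprK dotZl dotZr mulrA -expr2 -mulrA.
    rewrite ler_pM2l ?exprn_gt0 //.
    by have := dot_sum_le (fun s : 'I_T => (t < s)%N) g; rewrite card_ord.
  have := ler_wpM2l (ltW (divr_gt0 L0 (ltr0Sn _ 1))) q.
  move: D B; rewrite -/(g t) -/(a t) !dotDr !dotNr; lra.
have : \sum_t f t x' - \sum_t f t z <= eta^-1 * dot (x - x') (x' - z)
    + L / 2 * (eta ^+ 2 * T%:R ^+ 2 * \sum_s dot (g s) (g s))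
    - (2 * L)^-1 * \sum_t a t.
  rewrite -sumrB; apply: le_trans (ler_sum _ (fun t _ => per_t t)) _.
  rewrite !big_split /= sumrN -mulr_sumr sumr_const card_ord -dot_suml gE dotZl.
  rewrite mulKf ?gt_eqF // -[_ *+ T]mulr_natl.
  rewrite -[X in _ - X <= _]mulr_sumr.
  by rewrite le_eqVlt; apply/orP; left; apply/eqP; ring.
(* Each [g t] splits into its deviation from the gradient at [z], the change of that gradient
   between [xs] and [z], and the gradient at [xs]. *)
have gg : \sum_s dot (g s) (g s) <=
    beta * \sum_t a t + alpha * \sum_t b t + 2 * (T%:R * sigma2 f xs).
  rewrite -sigma2_sum !mulr_sumr -!big_split; apply: ler_sum => t _ /=.
  have := dot_young3 (g t - grad (f t) z) (- (grad (f t) xs - grad (f t) z))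
    (grad (f t) xs).
  rewrite dotNl dotNr opprK (_ : _ - _ - _ + _ = g t) //.
  by rewrite opprB addrA subrK subrK.
(* In the sum of [bregman_ge] at [xs], the linear terms vanish because the gradients there sum to
   zero. *)
have bb : (2 * L)^-1 * \sum_t b t <= \sum_t f t z - \sum_t f t xs.
  have : \sum_t (f t xs + dot (grad (f t) xs) (z - xs) + (2 * L)^-1 * b t)
      <= \sum_t f t z.
    by apply: ler_sum => t _; exact: bregman_ge.
  rewrite !big_split /= -dot_suml sum_grad_argmin dot0l -mulr_sumr; lra.
pose k := eta ^+ 2 * T%:R ^+ 2 * L ^+ 2.
have k0 : 0 <= k by rewrite /k -!exprMn sqr_ge0.
have kb : k * beta <= 1 := eta_sqr_bound.
have W0 : 0 < (2 * L)^-1 by rewrite invr_gt0 mulr_gt0.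
have a0 : 0 <= \sum_t a t by apply: sumr_ge0 => t _; exact: dot_ge0.
have b0 : 0 <= \sum_t b t by apply: sumr_ge0 => t _; exact: dot_ge0.
have kE (u : R) : L / 2 * (eta ^+ 2 * T%:R ^+ 2 * u) = k * ((2 * L)^-1 * u).
  by rewrite /k; field; rewrite gt_eqF.
rewrite kE.
(* The step-size condition [k beta <= 1] lets the gain in [a] absorb the first part of [gg], and
   turns the coefficient [k alpha] of the second into [alpha / beta]. The third part is the noise
   term. *)
have : k * ((2 * L)^-1 * \sum_s dot (g s) (g s)) <=
    (2 * L)^-1 * (\sum_t a t) + alpha / beta * (\sum_t f t z - \sum_t f t xs)
    + T%:R * (eta ^+ 2 * T%:R ^+ 2 * L * sigma2 f xs).
  apply: le_trans (ler_wpM2l k0 (ler_wpM2l (ltW W0) gg)) _.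
  rewrite [leLHS](_ : _ = k * ((2 * L)^-1 * (beta * \sum_t a t))
    + k * ((2 * L)^-1 * (alpha * \sum_t b t))
    + k * ((2 * L)^-1 * (2 * (T%:R * sigma2 f xs)))); last by ring.
  apply: lerD; first apply: lerD.
  - have -> : k * ((2 * L)^-1 * (beta * \sum_t a t)) =
      k * beta * ((2 * L)^-1 * \sum_t a t) by ring.
    by rewrite ler_piMl // mulr_ge0 // ltW.
  - have -> : k * ((2 * L)^-1 * (alpha * \sum_t b t)) =
      (k * beta) * (alpha / beta * ((2 * L)^-1 * \sum_t b t)).
      by field; rewrite !gt_eqF.
    have r0 : 0 <= alpha / beta by apply: divr_ge0; exact: ltW.
    apply: (@le_trans _ _ (alpha / beta * ((2 * L)^-1 * \sum_t b t))).
      rewrite ler_piMl //; apply: mulr_ge0 => //; apply: mulr_ge0 => //.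
      exact: ltW.
    by rewrite ler_wpM2l.
  - rewrite /k le_eqVlt; apply/orP; left; apply/eqP.
    by field; rewrite gt_eqF.
lra.
Qed.

(** The three-point identity turns [dot (x - x') (x' - z)] into a difference of squared distances;
    the leftover [- |x - x'|^2] is dropped and the sum is divided by [T]. *)
Lemma epoch_bound x z (x' := ipm_epoch eta f x) :
  favg f x' - favg f xs <= (1 + alpha / beta) * (favg f z - favg f xs)
    + (2 * eta * T%:R)^-1 * (dot (x - z) (x - z) - dot (x' - z) (x' - z))
    + eta ^+ 2 * T%:R ^+ 2 * L * sigma2 f xs.
Proof.
have := epoch_sum_bound x z; rewrite /= -/x' !favg_sum.
have -> : dot (x - x') (x' - z) =
    2^-1 * (dot (x - z) (x - z) - dot (x' - z) (x' - z) - dot (x - x') (x - x')).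
  have -> : x - z = (x - x') + (x' - z) by rewrite addrA subrK.
  move: (x - x') (x' - z) => u v.
  by rewrite !dotE (dotC v u); field.
have := dot_ge0 (x - x').
move: (dot (x - x') (x - x')) (dot (x - z) (x - z) - dot (x' - z) (x' - z)) => e D.
move=> e0 H; rewrite -(ler_pM2l T0).
have -> : T%:R * ((1 + alpha / beta) * (favg f z - favg f xs)
    + (2 * eta * T%:R)^-1 * D + eta ^+ 2 * T%:R ^+ 2 * L * sigma2 f xs) =
  T%:R * (favg f z - favg f xs) + alpha / beta * (T%:R * favg f z - T%:R * favg f xs)
    + eta^-1 * (2^-1 * D) + T%:R * (eta ^+ 2 * T%:R ^+ 2 * L * sigma2 f xs).
  by field; rewrite !gt_eqF.
have : eta^-1 * (2^-1 * (D - e)) <= eta^-1 * (2^-1 * D).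
  by rewrite ler_pM2l ?invr_gt0 // ler_pM2l ?invr_gt0 //; lra.
lra.
Qed.

(** Induction on the number of epochs after the first, for all start and reference points at once:
    the induction hypothesis is used from [x'] with the moved reference [z']. *)
Lemma iterate_bound (w : nat -> R) x z m :
  w 1%N = 1 -> (forall n, 0 < w n.+1) -> (forall n, w n.+2 <= w n.+1) ->
  (forall n, (1 + alpha / beta) * n.+1%:R * (w n.+1 - w n.+2) <= w n.+2) ->
  favg f (iter m.+1 (ipm_epoch eta f) x) - favg f xs <=
    (1 + alpha / beta) * m.+1%:R * w m.+1 * (favg f z - favg f xs)
    + w m.+1 * ((2 * eta * T%:R)^-1 * dot (x - z) (x - z))
    + (eta ^+ 2 * T%:R ^+ 2 * L * sigma2 f xs) * \sum_(1 <= j < m.+2) w j.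
Proof.
move=> w1 w0 wd wP; set E := eta ^+ 2 * T%:R ^+ 2 * L * sigma2 f xs.
set c := (2 * eta * T%:R)^-1; set r := 1 + alpha / beta.
have EB x1 z1 : favg f (ipm_epoch eta f x1) - favg f xs <=
    r * (favg f z1 - favg f xs) + c * (dot (x1 - z1) (x1 - z1)
      - dot (ipm_epoch eta f x1 - z1) (ipm_epoch eta f x1 - z1)) + E.
  exact: epoch_bound.
have c0 : 0 <= c by rewrite invr_ge0 !mulr_ge0 // ltW.
have r0 : 0 <= r by rewrite addr_ge0 // divr_ge0 // ltW.
elim: m x z => [|m IH] x z.
  have := EB x z; have := dot_ge0 (ipm_epoch eta f x - z).
  move=> /(mulr_ge0 c0); rewrite /= big_nat1 w1 !mulr1 mul1r mulrBr; lra.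
rewrite iterSr; set x' := ipm_epoch eta f x.
pose l := w m.+2 / w m.+1.
have lw : w m.+1 * l = w m.+2 by rewrite mulrCA divff ?mulr1 // gt_eqF.
have l01 : 0 <= l <= 1.
  by rewrite divr_ge0 ?(ltW (w0 _)) //= ler_pdivrMr // mul1r.
pose z' := l *: z + (1 - l) *: x'; apply: le_trans (IH x' z') _.
have Gz : w m.+1 * (favg f z' - favg f xs) <=
    (w m.+1 - w m.+2) * (favg f x' - favg f xs) + w m.+2 * (favg f z - favg f xs).
  have := ler_wpM2l (ltW (w0 m)) (favg_convex z x' l01).
  by rewrite -/z' -lw; nra.
have zz : dot (x' - z') (x' - z') = l ^+ 2 * dot (x' - z) (x' - z).
  have -> : x' - z' = l *: (x' - z).
    by apply/rowP => i; rewrite !mxE; ring.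
  by rewrite dotZl dotZr mulrA expr2.
(* Since [l^2 <= l], this distance is paid for by the negative term of the epoch inequality [Ex],
   which carries weight [w m.+2]. *)
have Dz : w m.+1 * (c * dot (x' - z') (x' - z')) <=
    w m.+2 * (c * dot (x' - z) (x' - z)).
  rewrite zz (_ : _ * (c * _) = w m.+1 * l * (c * dot (x' - z) (x' - z)) * l).
    rewrite lw ler_piMr //; last by case/andP: l01.
    apply: mulr_ge0; first exact: ltW.
    by apply: mulr_ge0 => //; exact: dot_ge0.
  ring.
have Fx : 0 <= favg f x' - favg f xs by rewrite subr_ge0; exact: xsP.
have Ex := ler_wpM2l (ltW (w0 m.+1)) (EB x z).
(* Convexity leaves the gap at [x'] with coefficient [r (m+1) (w m.+1 - w m.+2)]. By [wP] this is at
   most [w m.+2], its coefficient on the left of [Ex], so the gap at [x'] cancels. *)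
have Wx := ler_wpM2r Fx (wP m).
have rm0 : 0 <= r * m.+1%:R by rewrite mulr_ge0.
have Gz' := ler_wpM2l rm0 Gz.
rewrite [X in _ <= _ + _ * X]big_nat_recr //= -(natr1 m.+1).
move: Dz Ex Wx Gz'; rewrite -/x' -/r -/c; move: (\sum_(_ <= _ < _) _) => S.
move: (dot (x' - z') _) (dot (x' - z) _) (dot (x - z) _) => D1 D2 D3.
move: (favg f x' - _) (favg f z - _) (favg f z' - _) => F1 F2 F3.
move: (w m.+1) (w m.+2) (m.+1%:R) => W1 W2 M.
move=> Dz Ex Wx Gz'; lra.
Qed.

Lemma ipm_constE x K : ipm (fun=> eta) f x K = iter K (ipm_epoch eta f) x.
Proof. by elim: K => //= K ->. Qed.

Lemma ipm_bound x K : (1 <= K)%N ->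
  favg f (ipm (fun=> eta) f x K) - favg f xs <=
    eta ^+ 2 * T%:R ^+ 2 * sigma2 f xs * L * (1 + beta / alpha)
      * K%:R `^ ((alpha / beta) / (1 + alpha / beta))
    + enorm (x - xs) ^+ 2
      / (2 * T%:R * eta * K%:R `^ (1 / (1 + alpha / beta))).
Proof.
case: K => // m _; rewrite ipm_constE.
have r0 : 0 < alpha / beta by rewrite divr_gt0.
set s := 1 / (1 + alpha / beta).
have s0 : 0 < s by rewrite divr_gt0 // addr_gt0.
have s1 : s < 1 by rewrite ltr_pdivrMr ?addr_gt0 // mul1r ltrDl.
have s01 : 0 < s <= 1 by rewrite s0 ltW.
pose w n : R := (n%:R `^ s)^-1.
have p0 n : 0 < n.+1%:R `^ s :> R by rewrite powR_gt0 // ltr0n.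
have wd n : w n.+2 <= w n.+1.
  by rewrite /w lef_pV2 ?posrE ?p0 // ge0_ler_powR ?nnegrE ?ltW // ltr_nat.
have wP n : (1 + alpha / beta) * n.+1%:R * (w n.+1 - w n.+2) <= w n.+2.
  have := powR_succ_le n s01; have := p0 n; have := p0 n.+1; rewrite /w.
  move: (n.+2%:R `^ s) (n.+1%:R `^ s) => P Q P0 Q0 H.
  have -> : (1 + alpha / beta) * n.+1%:R * (Q^-1 - P^-1) =
     (1 + alpha / beta) * (n.+1%:R * P - n.+1%:R * Q) / (Q * P).
    by field; rewrite !gt_eqF.
  have -> : P^-1 = (1 + alpha / beta) * (s * Q) / (Q * P).
    by rewrite /s; field; rewrite !gt_eqF // addr_gt0.
  rewrite ler_pM2r ?invr_gt0 ?mulr_gt0 // ler_pM2l ?addr_gt0 //; lra.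
(* Starting with the reference [z = xs] makes the term in the gap at [z] vanish. *)
have := @iterate_bound w x xs m _ _ wd wP.
rewrite /w /= powR1 invr1 subrr mulr0 add0r => /(_ erefl).
move=> /(_ (fun n => _)) H; apply: le_trans (H _) _ => [n|].
  by rewrite invr_gt0 p0.
have aE : alpha / beta / (1 + alpha / beta) = 1 - s.
  by rewrite /s; field; rewrite !gt_eqF // addr_gt0.
(* This factor is the [1 / (1 - s)] produced by [sum_powR_le]. *)
have -> : 1 + beta / alpha = (alpha / beta / (1 + alpha / beta))^-1.
  by field; rewrite !gt_eqF // addr_gt0.
rewrite aE.
rewrite addrC; apply: lerD.
  have s01' : 0 < s < 1 by rewrite s0.
  have := sum_powR_le m.+1 s01'.
  have E0 : 0 <= eta ^+ 2 * T%:R ^+ 2 * L * sigma2 f xs.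
    by rewrite mulr_ge0 ?sigma2_ge0 // -exprMn mulr_ge0 ?sqr_ge0 // ltW.
  move=> /(ler_wpM2l E0) H1; apply: le_trans H1 _.
  by rewrite le_eqVlt; apply/orP; left; apply/eqP; ring.
rewrite enorm_sqr le_eqVlt; apply/orP; left; apply/eqP.
by field; rewrite !gt_eqF.
Qed.

End Epoch.

(** * Choice of the number of epochs and of the step size *)

Section Complexity.
Context {R : realType}.

Lemma expR1_ge2 : 2 <= expR 1 :> R.
Proof. by have := @expR_ge1Dx R 1; lra. Qed.

Lemma ln_le_subr1 (x : R) : 0 < x -> ln x <= x - 1.
Proof.
move=> x0; have := @le_ln1Dx R (x - 1).
by rewrite addrCA subrr addr0; apply; lra.
Qed.

Lemma ln_natr_gt0 (K : nat) : 1 <= ln (K%:R : R) -> (0 < K)%N.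
Proof. by case: K => //; rewrite ln0 // ler10. Qed.

(** Resolves the implicit condition [K >= c Y ln K]: for [K] close to a large multiple of
    [Y ln (e + Y)], [ln K] is of the order of [ln (e + Y)]. *)
Lemma exists_epochs (c : R) : expR 1 <= c -> exists2 A : R, 0 < A &
  forall Y : R, 1 <= Y -> exists K : nat,
    [/\ 1 <= ln (K%:R : R), c * ln K%:R * Y <= K%:R &
        K%:R <= A * Y * ln (expR 1 + Y)].
Proof.
move=> ec; have e2 := expR1_ge2; have c1 : 1 <= c by lra.
(* With this value [2 A = (8 c)^2], so [ln (2 A) <= 16 c], and [c (16 c + 2) <= A]. The exported
   constant is [2 A], the factor 2 paying for rounding up to an integer. *)
have [A AE] : exists A, A = 32 * c ^+ 2 by exists (32 * c ^+ 2).
have cc : c <= c ^+ 2 by nra.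
have Ac : 32 * c <= A by rewrite AE; lra.
have lnA : ln (2 * A) <= 16 * c.
  have -> : 2 * A = (8 * c) ^+ 2 by rewrite AE; ring.
  rewrite lnXn ?mulr_gt0 //; last by lra.
  have : ln (8 * c) <= 8 * c - 1 by apply: ln_le_subr1; lra.
  by rewrite -mulr_natl; lra.
exists (2 * A); first by lra.
move=> Y Y1; set N := ln (expR 1 + Y).
have N1 : 1 <= N.
  by rewrite -[1](@expRK R) ler_ln ?posrE ?expR_gt0 //; lra.
have YN : ln Y <= N by rewrite ler_ln ?posrE //; lra.
have NN : ln N <= N by have := @ln_le_subr1 N; lra.
have P1 : 1 <= Y * N by nra.
have AP : A <= A * (Y * N) by rewrite ler_peMr //; lra.
have [K /andP[K1 K2]] : exists K : nat, A * (Y * N) <= K%:R <= A * (Y * N) + 1.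
  exists (Num.truncn (A * (Y * N))).+1.
  have /truncn_itv/andP[] : 0 <= A * (Y * N) by lra.
  by rewrite -natr1 => H1 H2; rewrite ltW //= lerD2r.
exists K; have K0 : A <= K%:R := le_trans AP K1.
split=> //.
- by rewrite -[leLHS](@expRK R) ler_ln ?posrE ?expR_gt0 //; lra.
- have lK : ln K%:R <= (16 * c + 2) * N.
    have : ln K%:R <= ln (2 * A * (Y * N)) by rewrite ler_ln ?posrE //; lra.
    rewrite lnM ?posrE //; [|lra|lra].
    rewrite (lnM (x := Y)) ?posrE //; [|lra|lra].
    have : 0 <= c * (N - 1) by apply: mulr_ge0; lra.
    lra.
  apply: le_trans K1; rewrite mulrAC.
  have : c * Y * ln K%:R <= c * Y * ((16 * c + 2) * N) by rewrite ler_wpM2l //; nra.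
  move/le_trans; apply.
  have -> : c * Y * ((16 * c + 2) * N) = (16 * c ^+ 2 + 2 * c) * (Y * N) by ring.
  by rewrite AE ler_wpM2r //; lra.
- by rewrite -!mulrA; lra.
Qed.

Lemma ipm_bound_log (d T : nat) (L : R) (f : 'I_T -> 'rV[R]_d -> R)
    (xs x0 : 'rV[R]_d) (eta : R) (K : nat) :
  (1 <= T)%N -> 0 < L ->
  (forall t, convex_fun (f t)) -> (forall t, smooth L (f t)) ->
  argmin (favg f) xs -> 1 <= ln (K%:R : R) ->
  0 < eta -> eta <= 1 / (Num.sqrt (4 * ln K%:R) * T%:R * L) ->
  favg f (ipm (fun=> eta) f x0 K) - favg f xs <=
    expR 1 * (eta * T%:R) ^+ 2 * sigma2 f xs * L * (1 + ln K%:R)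
    + expR 1 * enorm (x0 - xs) ^+ 2 / (2 * (eta * T%:R) * K%:R).
Proof.
move=> T1 L0 cf Sf xsP l1 eta0 etaP.
have T0 : 0 < T%:R :> R by rewrite ltr0n.
have K1 := ln_natr_gt0 l1.
have K0 : 0 < K%:R :> R by rewrite ltr0n.
have lE : K%:R = expR (ln K%:R) :> R by rewrite lnK // posrE.
set l := ln K%:R in l1 etaP lE *.
have l0 : 0 < l by lra.
have ab : 4^-1 + (4 * l)^-1 <= 1 / 2 :> R.
  have : (4 * l)^-1 <= 4^-1 by rewrite lef_pV2 ?posrE //; lra.
  lra.
have b0 : 0 < 4 * l by lra.
have := ipm_bound T1 L0 cf Sf xsP (ltr0n _ 4) b0 ab eta0 etaP x0 K1.
have -> : 1 + 4 * l / 4 = 1 + l by field.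
have -> : 4 / (4 * l) / (1 + 4 / (4 * l)) = (1 + l)^-1.
  by field; rewrite !gt_eqF //; lra.
have -> : 1 / (1 + 4 / (4 * l)) = 1 - (1 + l)^-1.
  by field; rewrite !gt_eqF //; lra.
set P := K%:R `^ (1 + l)^-1 => H.
(* [ln P = ln K / (1 + ln K) <= 1]: the choice [beta = 4 ln K] makes both powers of [K] cost at most
   a factor [e]. *)
have Pe : P <= expR 1.
  rewrite /P /powR gt_eqF // -/l ler_expR -ler_pdivlMl ?invr_gt0 ?invrK; lra.
have P0 : 0 < P by rewrite powR_gt0.
apply: le_trans H _; apply: lerD.
  rewrite [leRHS](_ : _ =
    eta ^+ 2 * T%:R ^+ 2 * sigma2 f xs * L * (1 + l) * expR 1); last by ring.
  rewrite ler_wpM2l // -exprMn mulr_ge0 //; last by lra.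
  by rewrite mulr_ge0 ?(ltW L0) // mulr_ge0 ?sqr_ge0 ?sigma2_ge0.
have -> : K%:R `^ (1 - (1 + l)^-1) = K%:R / P.
  rewrite powRD ?powRr1 ?powRN // ?(ltW K0) //.
  by rewrite (gt_eqF K0) implybT.
have -> : enorm (x0 - xs) ^+ 2 / (2 * T%:R * eta * (K%:R / P)) =
    enorm (x0 - xs) ^+ 2 / (2 * (eta * T%:R) * K%:R) * P.
  by field; rewrite !gt_eqF.
rewrite mulrC -[leRHS]mulrA ler_wpM2r //.
by rewrite divr_ge0 ?sqr_ge0 // !mulr_ge0 ?ltW.
Qed.

Lemma powR32 (x : R) : 0 < x -> x `^ (3 / 2) = x * Num.sqrt x.
Proof.
move=> x0; have -> : 3 / 2 = 1 + 2^-1 :> R by field.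
rewrite powRD; last by rewrite gt_eqF // implybT.
by rewrite powRr1 ?powR12_sqrt ?ltW.
Qed.

(* The step is [eta = h / T] with [1/h = 2 e l (L + sigma sqrt (L / eps))]:
   adding the two constraints on [1/h], instead of taking their maximum, makes
   [|x0 - xs|^2 / (h eps)] equal to [2 e l] times [query_scale / T]. *)
Lemma ipm_eps_accurate (d T : nat) (L : R) (f : 'I_T -> 'rV[R]_d -> R)
    (xs x0 : 'rV[R]_d) (eps : R) (K : nat) :
  (1 <= T)%N -> 0 < L ->
  (forall t, convex_fun (f t)) -> (forall t, smooth L (f t)) ->
  argmin (favg f) xs -> 0 < eps -> 1 <= ln (K%:R : R) ->
  2 * expR 1 ^+ 2 * ln K%:R * (query_scale L f x0 xs eps / T%:R) <= K%:R ->
  exists eta : R, [/\ 0 < eta,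
    eta <= 1 / (Num.sqrt (4 * ln K%:R) * T%:R * L) &
    favg f (ipm (fun=> eta) f x0 K) - favg f xs <= eps].
Proof.
move=> T1 L0 cf Sf xsP eps0 l1 KP.
have T0 : 0 < T%:R :> R by rewrite ltr0n.
have e2 := expR1_ge2; set e := expR 1 in e2 KP.
set l := ln K%:R in l1 KP *.
have s20 : 0 <= sigma2 f xs := sigma2_ge0 f xs.
pose sq := Num.sqrt (sigma2 f xs); pose sL := Num.sqrt L.
pose se := Num.sqrt eps.
have sq0 : 0 <= sq by rewrite sqrtr_ge0.
have sL0 : 0 < sL by rewrite sqrtr_gt0.
have se0 : 0 < se by rewrite sqrtr_gt0.
have sqE : sigma2 f xs = sq ^+ 2 by rewrite sqr_sqrtr.
have sLE : L = sL ^+ 2 by rewrite sqr_sqrtr // ltW.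
have seE : eps = se ^+ 2 by rewrite sqr_sqrtr // ltW.
pose Q := L + sq * sL / se.
have q0 : 0 <= sq * sL / se := divr_ge0 (mulr_ge0 sq0 (ltW sL0)) (ltW se0).
have Q0 : 0 < Q by rewrite ltr_pwDl.
have K0 : 0 < K%:R :> R by rewrite ltr0n ln_natr_gt0.
have XE : query_scale L f x0 xs eps / T%:R = Q * enorm (x0 - xs) ^+ 2 / eps.
  rewrite /query_scale powR32 // -/sq -/sL -/se /Q.
  by field; rewrite !gt_eqF.
have D0 : 0 <= enorm (x0 - xs) ^+ 2 by exact: sqr_ge0.
have el0 : 0 < 2 * e * l by rewrite !mulr_gt0 //; lra.
pose h := (2 * e * l * Q)^-1.
have h0 : 0 < h by rewrite invr_gt0 mulr_gt0.
have hE : h * (2 * e * l * Q) = 1 by rewrite mulVf // gt_eqF // mulr_gt0.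
exists (h / T%:R); have hT : h / T%:R * T%:R = h by rewrite divfK // gt_eqF.
have eta0 : 0 < h / T%:R by rewrite divr_gt0.
have etaP : h / T%:R <= 1 / (Num.sqrt (4 * l) * T%:R * L).
  have sl0 : 0 < Num.sqrt (4 * l) by rewrite sqrtr_gt0; lra.
  have sl : Num.sqrt (4 * l) <= 2 * l.
    rewrite -(ler_pXn2r (ltn0Sn 1)) ?nnegrE ?sqrtr_ge0 //; last by lra.
    by rewrite sqr_sqrtr; nra.
  rewrite ler_pdivlMr ?mulr_gt0 //.
  have -> : h / T%:R * (Num.sqrt (4 * l) * T%:R * L) = h * (Num.sqrt (4 * l) * L).
    by field; rewrite gt_eqF.
  rewrite -[leRHS]hE ler_pM2l //.
  apply: (@le_trans _ _ (2 * l * L)); first by rewrite ler_wpM2r // ltW.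
  apply: (@le_trans _ _ (2 * l * Q)); first by rewrite ler_wpM2l ?lerDl //; lra.
  by rewrite ler_pM2r //; nra.
split=> //; apply: le_trans (ipm_bound_log x0 T1 L0 cf Sf xsP l1 eta0 etaP) _.
rewrite hT -/e -/l.
have v0 : 0 <= h * sq * sL := mulr_ge0 (mulr_ge0 (ltW h0) sq0) (ltW sL0).
have v1 : 2 * e * l * (h * sq * sL) <= se.
  rewrite -[leRHS]mul1r -ler_pdivrMr // -[leRHS]hE.
  have -> : 2 * e * l * (h * sq * sL) / se = h * (2 * e * l * (sq * sL / se)) by ring.
  by rewrite ler_pM2l // ler_pM2l // lerDr ltW.
have B1 : e * h ^+ 2 * sigma2 f xs * L * (1 + l) <= eps / 2.
  have : (2 * e * l * (h * sq * sL)) ^+ 2 <= eps.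
    by rewrite seE ler_pXn2r ?nnegrE ?(ltW se0) // mulr_ge0 // ltW.
  rewrite sqE sLE.
  have -> : e * h ^+ 2 * sq ^+ 2 * sL ^+ 2 * (1 + l) =
    e * (1 + l) * (h * sq * sL) ^+ 2 by ring.
  rewrite exprMn; have : 0 <= (h * sq * sL) ^+ 2 by exact: sqr_ge0.
  (* Here [l >= 1] gives [1 + l <= 2 l^2], and [e <= e^2]. *)
  have : 2 * (e * (1 + l)) <= (2 * e * l) ^+ 2.
    have : 0 <= e * ((e - 1) * l ^+ 2) by rewrite !mulr_ge0 ?sqr_ge0; lra.
    have : 1 + l <= 2 * l ^+ 2 by nra.
    by nra.
  by move: ((_ * _) ^+ 2) ((_ * _) ^+ 2) (e * (1 + l)) => a b c; nra.
(* Multiplied by [eps h], the condition on [K] reads [e |x0 - xs|^2 <= eps h K]. *)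
have B2 : e * enorm (x0 - xs) ^+ 2 / (2 * h * K%:R) <= eps / 2.
  rewrite ler_pdivrMr ?mulr_gt0 //.
  have := ler_wpM2l (mulr_ge0 (ltW eps0) (ltW h0)) KP; rewrite XE.
  have -> : eps * h * (2 * e ^+ 2 * l * (Q * enorm (x0 - xs) ^+ 2 / eps)) =
      h * (2 * e * l * Q) * e * enorm (x0 - xs) ^+ 2 by field; rewrite gt_eqF.
  rewrite hE; lra.
lra.
Qed.

End Complexity.

Theorem theorem3p1 (R : realType) :
  (forall (d T : nat) (L : R) (f : 'I_T -> 'rV[R]_d -> R)
      (xs x0 : 'rV[R]_d) (alpha beta eta : R) (K : nat),
    (1 <= T)%N -> 0 < L ->
    (forall t, convex_fun (f t)) -> (forall t, smooth L (f t)) ->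
    argmin (favg f) xs ->
    0 < alpha -> 0 < beta -> alpha^-1 + beta^-1 <= 1 / 2 ->
    0 < eta -> eta <= 1 / (Num.sqrt beta * T%:R * L) ->
    (1 <= K)%N ->
    favg f (ipm (fun=> eta) f x0 K) - favg f xs <=
      expR 1 * eta ^+ 2 * T%:R ^+ 2 * sigma2 f xs * L * (1 + beta / alpha)
        * K%:R `^ ((alpha / beta) / (1 + alpha / beta))
      + expR 1 * enorm (x0 - xs) ^+ 2
        / (2 * T%:R * eta * K%:R `^ (1 / (1 + alpha / beta))))
  /\
  (exists C p : R, 0 < C /\ 0 < p /\
    forall (d T : nat) (L : R) (f : 'I_T -> 'rV[R]_d -> R)
      (xs x0 : 'rV[R]_d) (eps : R),
    (1 <= T)%N -> 0 < L ->
    (forall t, convex_fun (f t)) -> (forall t, smooth L (f t)) ->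
    argmin (favg f) xs ->
    0 < eps ->
    let X := query_scale L f x0 xs eps in
    T%:R <= X ->
    exists (K : nat) (eta : R),
      let beta := 4 * ln K%:R in
      1 <= ln (K%:R : R) /\
      0 < eta /\ eta <= 1 / (Num.sqrt beta * T%:R * L) /\
      favg f (ipm (fun=> eta) f x0 K) - favg f xs <= eps /\
      T%:R * K%:R <= C * X * (ln (expR 1 + X)) `^ p).
Proof.
have e2 := @expR1_ge2 R.
split=> [d T L f xs x0 alpha beta eta K T1 L0 cf Sf xsP a0 b0 ab eta0 etaP K1|].
  have := ipm_bound T1 L0 cf Sf xsP a0 b0 ab eta0 etaP x0 K1.
  set u := (X in _ <= X + _); set v := (X in _ <= _ + X) => H.
  have u0 : 0 <= u.
    rewrite /u -exprMn mulr_ge0 ?powR_ge0 // mulr_ge0 //; last first.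
      by rewrite addr_ge0 // divr_ge0 // ltW.
    by rewrite mulr_ge0 ?(ltW L0) // mulr_ge0 ?sqr_ge0 ?sigma2_ge0.
  have v0 : 0 <= v.
    apply: divr_ge0; first exact: sqr_ge0.
    apply: mulr_ge0; last exact: powR_ge0.
    by apply: mulr_ge0; [exact: mulr_ge0 | exact: ltW].
  (* [ipm_bound] has no factor [e]; both summands are nonnegative, so multiplying them by [e >= 1]
     only weakens it. *)
  apply: le_trans H _; apply: (@le_trans _ _ (expR 1 * u + expR 1 * v)).
    by apply: lerD; rewrite ler_peMl //; lra.
  by rewrite /u /v !mulrA.
have [|A A0 HA] := @exists_epochs R (2 * expR 1 ^+ 2); first by nra.
exists A, 1; split=> //; split=> //.
move=> d T L f xs x0 eps T1 L0 cf Sf xsP eps0 X TX.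
have T0 : 0 < T%:R :> R by rewrite ltr0n.
(* The regime [T <= X] is exactly [Y >= 1] for [Y = X / T]. A single logarithm suffices, hence
   [p = 1]. *)
have [|K [l1 KP KA]] := HA (X / T%:R); first by rewrite ler_pdivlMr // mul1r.
have [eta [eta0 etaP H]] := ipm_eps_accurate T1 L0 cf Sf xsP eps0 l1 KP.
exists K, eta => /=; do 4 split=> //.
have X0 : 0 < X by exact: lt_le_trans TX.
have XT : X / T%:R <= X by rewrite ler_pdivrMr // ler_peMr ?(ltW X0) // ler1n.
have XT0 : 0 < X / T%:R by rewrite divr_gt0.
have lnX : ln (expR 1 + X / T%:R) <= ln (expR 1 + X).
  by rewrite ler_ln ?posrE; lra.
have ln0 : 0 <= ln (expR 1 + X) by apply: ln_ge0; lra.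
rewrite powRr1 //.
have := ler_wpM2l (ltW T0) KA.
have -> : T%:R * (A * (X / T%:R) * ln (expR 1 + X / T%:R)) =
    A * X * ln (expR 1 + X / T%:R) by field; rewrite gt_eqF.
move/le_trans; apply; rewrite ler_wpM2l //.
by apply: mulr_ge0; exact: ltW.
Qed.
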